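(* Let $G=(V,E,\mathbf c)$ be a capacitated undirected graph and $\alpha\ge1$, $\beta\ge1$. Let $\mathcal P_1,\dots,\mathcal P_L$ be partitions of subsets $V_1,\dots,V_L\subseteq V$ respectively. Let $\overline{\mathcal P}_0$ be the singleton partition $\{\{v\}:v\in V\}$, and for $i\in[L]$ define $\mathcal Q_i=\{C\cap(V\setminus V_i):C\in\overline{\mathcal P}_{i-1},\ C\cap(V\setminus V_i)\ne\emptyset\}$ and $\overline{\mathcal P}_i=\mathcal P_i\cup\mathcal Q_i$ (a partition of $V$). Suppose: 1. $\overline{\mathcal P}_1=\{\{v\}:v\in V\}$ and $\overline{\mathcal P}_L=\{V\}$; 2. for each $i\in[L-1]$, the collection of vertex weightings $\{\deg_{\partial\overline{\mathcal P}_i\cup\partial C}|_C : C\in\overline{\mathcal P}_{i+1},\ C\subseteq V_{i+1}\}$ mixes simultaneously in $G$ with congestion $\alpha$; 3. for each $i\in[L-1]$, there is a flow in $G$ with congestion $\beta$ such that each $v\in V_{i+1}$ sends $\deg_{\partial\overline{\mathcal P}_{i+1}}(v)$ flow and receives at most $\frac14\deg_{\partial\overline{\mathcal P}_i}(v)$ flow. For $i\in[L]$ let $\mathcal R_{\ge i}=\{C_i\cap\dots\cap C_L : C_j\in\overline{\mathcal P}_j\ (i\le j\le L),\ C_i\cap\dots\cap C_L\ne\emptyset\}$ be the common refinement of $\overline{\mathcal P}_i,\dots,\overline{\mathcal P}_L$. Then $\mathcal C=\bigcup_{i\in[L]}\mathcal R_{\ge i}$ is a congestion-approximator of $G$ with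 quality $48\alpha\beta L^2$.
   Context: For $S\subseteq V$, $\partial S$ is the set of edges with exactly one endpoint in $S$, $\delta S$ its total capacity. For a partition $\mathcal P$ of $V$, $\partial\mathcal P$ is the set of edges with endpoints in different parts. For an edge set $F$, $\deg_F(v)$ is the total capacity of edges of $F$ incident to $v$. For $\mathbf x\in\mathbb R^V$, $\mathbf x(S)=\sum_{v\in S}\mathbf x(v)$ and $\mathbf x|_C$ equals $\mathbf x$ on $C$ and $0$ elsewhere; vector inequalities and $|\cdot|$ are entrywise. A demand is $\mathbf b\in\mathbb R^V$ with $\mathbf b(V)=0$; a flow routes $\mathbf b$ if the net outflow at each $v$ is $\mathbf b(v)$; congestion $\kappa$ means the flow on each edge $e$ is at most $\kappa\mathbf c(e)$. A collection $\{\mathbf d_i\}$ mixes simultaneously with congestion $\kappa$ if for every tuple of demands $\mathbf b_i$ with $|\mathbf b_i|\le\mathbf d_i$ there is a multicommodity flow, commodity $i$ routing $\mathbf b_i$, with total flow on each edge at most $\kappa\mathbf c(e)$. A congestion-approximator of quality $q$ is a family $\mathcal C$ of subsets of $V$ such that every demand $\mathbf b$ with $|\mathbf b(C)|\le\delta C$ for all $C\in\mathcal C$ can be routed with congestion $q$. *)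

(* Defs.v *)
From mathcomp Require Import all_boot all_order all_algebra.
From mathcomp Require Import reals.

Set Implicit Arguments.
Unset Strict Implicit.
Unset Printing Implicit Defensive.

Import Order.TTheory GRing.Theory Num.Theory.

Local Open Scope ring_scope.

(* Parallel edges are allowed. The orientation src -> dst of an edge is        *)
(* arbitrary: it only fixes the sign convention for flows.                     *)
Record capgraph (R : realType) (V E : finType) := CapGraph {
  src : E -> V;
  dst : E -> V;
  cap : E -> R;
  cap_ge0 : forall e, 0 <= cap e
}.

Definition vsum (R : realType) (V : finType) (x : V -> R) (S : {set V}) : R :=
  \sum_(v in S) x v.

Definition vrestr (R : realType) (V : finType) (x : V -> R) (S : {set V}) :
  V -> R := fun v => if v \in S then x v else 0.

Definition is_demand (R : realType) (V : finType) (b : V -> R) : Prop :=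
  vsum b [set: V] = 0.

Section Graph.
Variables (R : realType) (V E : finType) (G : capgraph R V E).

Definition bd (S : {set V}) : {set E} :=
  [set e | (src G e \in S) != (dst G e \in S)].

Definition bdcap (S : {set V}) : R := \sum_(e in bd S) cap G e.

Definition pbd (P : {set {set V}}) : {set E} :=
  [set e | pblock P (src G e) != pblock P (dst G e)].

Definition deg (F : {set E}) (v : V) : R :=
  \sum_(e in F | (src G e == v) || (dst G e == v)) cap G e.

(* A flow is a signed function f on edges: f e units travel from src e to      *)
(* dst e, or - f e units the other way round when f e < 0.                     *)
Definition netout (f : E -> R) (v : V) : R :=
  \sum_(e | src G e == v) f e - \sum_(e | dst G e == v) f e.

Definition routes (f : E -> R) (b : V -> R) : Prop :=
  forall v, netout f v = b v.

Definition congestion_le (f : E -> R) (kappa : R) : Prop :=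
  forall e, `|f e| <= kappa * cap G e.

(* Each v in S sends s v and receives some amount r v between 0 and t v;       *)
(* vertices outside S neither send nor receive, so flow is conserved there.    *)
Definition sends_receives (f : E -> R) (S : {set V}) (s t : V -> R) : Prop :=
  exists2 r : V -> R, (forall v, v \in S -> 0 <= r v <= t v)
    & routes f (vrestr (fun v => s v - r v) S).

Definition mixes_simultaneously (I : finType) (A : {set I}) (d : I -> V -> R)
    (kappa : R) : Prop :=
  forall b : I -> V -> R,
    (forall i, i \in A -> is_demand (b i)) ->
    (forall i, i \in A -> forall v, `|b i v| <= d i v) ->
  exists2 f : I -> E -> R, (forall i, i \in A -> routes (f i) (b i))
    & forall e, \sum_(i in A) `|f i e| <= kappa * cap G e.

Definition congestion_approximator (C : {set {set V}}) (q : R) : Prop :=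
  forall b : V -> R, is_demand b ->
    (forall S, S \in C -> `|vsum b S| <= bdcap S) ->
  exists2 f : E -> R, routes f b & congestion_le f q.

End Graph.

Section Hierarchy.
Variable V : finType.

Definition singletons : {set {set V}} := [set [set v] | v in [set: V]].

Variables (Vs : nat -> {set V}) (P : nat -> {set {set V}}).

Fixpoint Pbar (i : nat) : {set {set V}} :=
  if i is j.+1 then
    P i :|: [set C :&: ~: Vs i | C in Pbar j & C :&: ~: Vs i != set0]
  else singletons.

(* F picks a part C_j = F j for each j in [i, L]; the values F j with j < i    *)
(* are irrelevant.                                                             *)
Definition refinement_ge (L i : nat) : {set {set V}} :=
  [set S : {set V} | (S != set0) &&
    [exists F : {ffun 'I_L.+1 -> {set V}},
       [forall j : 'I_L.+1, (i <= j)%N ==> (F j \in Pbar j)]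
       && (S == \bigcap_(j < L.+1 | (i <= j)%N) F j)]].

Definition approx_family (L : nat) : {set {set V}} :=
  \bigcup_(1 <= i < L.+1) refinement_ge L i.

End Hierarchy.

(* Main.v *)
(* For v in V let S_i(v) be the part of v in the refinement R_{>= i}, and let b_i
   spread the demand b(S) of each part S over its vertices proportionally to
   deg_{bd S}. Then b_1 = b and b_L = 0, so it is enough to route each
   b_i - b_{i+1}. This difference vanishes outside V_{i+1}, sums to 0 on every
   part of level i+1, and is at most twice the degrees in the union of the
   boundaries of levels i, ..., L. Superposing the given flows of all levels
   above i, each scaled by 8, moves such an amount down to 4 times the degrees
   in the boundary of level i, with congestion O(beta L). Restricting that flow
   to the interiors of the parts of level i+1 leaves a remainder that has zero
   sum on each part and is mixed with congestion O(alpha beta L). *)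
Require Import Defs.
From mathcomp Require Import all_boot all_order all_algebra.
From mathcomp Require Import reals.
From mathcomp Require classical_sets.
From mathcomp Require Import ring lra.

Set Implicit Arguments.
Unset Strict Implicit.
Unset Printing Implicit Defensive.

Import Order.TTheory GRing.Theory Num.Theory.

Local Open Scope ring_scope.

(* Knaster-Tarski on the complete lattice [-1, 1]^T. *)
Lemma monotone_box_fixpoint (R : realType) (T : Type)
    (M : (T -> R) -> T -> R)
    (Mbox : forall p, (forall t, `|p t| <= 1) -> forall t, `|M p t| <= 1)
    (Mmono : forall p q, (forall t, p t <= q t) -> forall t, M p t <= M q t) :
  exists2 p : T -> R, (forall t, `|p t| <= 1) & forall t, p t = M p t.
Proof.
pose K (q : T -> R) := (forall t, `|q t| <= 1) /\ (forall t, q t <= M q t).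
pose A t : classical_sets.set R := fun y => exists2 q, K q & y = q t.
pose p t := sup (A t).
have K0 : K (fun=> -1).
  have H (t : T) : `|(-1 : R)| <= 1 by rewrite normrN1.
  split=> // t; have := Mbox _ H t; rewrite ler_norml => /andP[] //.
have A0 t : classical_sets.nonempty (A t) by exists (-1), (fun=> -1).
have Aub t : classical_sets.ubound (A t) 1.
  by move=> _ [q [q1 _] ->]; rewrite (le_trans (ler_norm _)).
have leKp q t : K q -> q t <= p t.
  by move=> Kq; apply: ub_le_sup; [exists 1; exact: Aub | exists q].
have pbox t : `|p t| <= 1.
  by rewrite ler_norml (leKp _ t K0) /=; apply: ge_sup.
have pM t : p t <= M p t.
  apply: ge_sup => // _ [q Kq ->].
  by apply: (le_trans (Kq.2 t)); apply: Mmono => s; exact: leKp.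
exists p => // t; apply/eqP; rewrite eq_le pM /=.
apply: (@leKp (M p)); split; first exact: Mbox.
by move=> s; apply: Mmono.
Qed.

(** * Incidence sums, degrees and transport of demands along a flow *)

Section Flows.
Variables (R : realType) (V E : finType) (G : capgraph R V E).
Implicit Types (f g a : E -> R) (x s r : V -> R) (v : V) (e : E).

(* A loop is counted twice, unlike in [deg]. *)
Definition inc a v : R := \sum_(e | src G e == v) a e + \sum_(e | dst G e == v) a e.

Lemma ler_inc a a' v :
  (forall e, (src G e == v) || (dst G e == v) -> a e <= a' e) -> inc a v <= inc a' v.
Proof. by move=> h; apply: lerD; apply: ler_sum => e ev; apply: h; rewrite ev ?orbT. Qed.

Lemma incZ k a v : inc (fun e => k * a e) v = k * inc a v.
Proof. by rewrite /inc mulrDr !mulr_sumr. Qed.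

Lemma incB a a' v : inc (fun e => a e - a' e) v = inc a v - inc a' v.
Proof. by rewrite /inc !sumrB; ring. Qed.

Lemma netoutD f g v : netout G (fun e => f e + g e) v = netout G f v + netout G g v.
Proof. by rewrite /netout !big_split /=; ring. Qed.

Lemma netoutB f g v : netout G (fun e => f e - g e) v = netout G f v - netout G g v.
Proof. by rewrite /netout !sumrB; ring. Qed.

Lemma netoutZ k f v : netout G (fun e => k * f e) v = k * netout G f v.
Proof. by rewrite /netout mulrBr !mulr_sumr. Qed.

Lemma netout_sum (I : finType) (A : {set I}) (f : I -> E -> R) v :
  netout G (fun e => \sum_(i in A) f i e) v = \sum_(i in A) netout G (f i) v.
Proof. by rewrite /netout sumrB; congr (_ - _); rewrite exchange_big. Qed.

Lemma ler_norm_netout f v : `|netout G f v| <= inc (fun e => `|f e|) v.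
Proof.
rewrite /netout (le_trans (ler_normB _ _))//.
by apply: lerD; apply: ler_norm_sum.
Qed.

(** Capacity cut down to [F] as a function on edges: degrees become values of [inc] and can be
    compared edge by edge with [ler_inc]. *)
Definition edgecap (F : {set E}) e : R := (e \in F)%:R * cap G e.

Lemma edgecap_ge0 F e : 0 <= edgecap F e.
Proof. by rewrite mulr_ge0 ?ler0n ?cap_ge0. Qed.

Lemma degE (F : {set E}) v :
  (forall e, e \in F -> src G e != dst G e) -> deg G F v = inc (edgecap F) v.
Proof.
move=> noloop; rewrite /deg /inc big_mkcond [X in X + _]big_mkcond.
rewrite [X in _ + X]big_mkcond -big_split /=; apply: eq_bigr => e _.
rewrite /edgecap; case: (boolP (e \in F)) => [/noloop|_] /=; last first.
  by rewrite mul0r !if_same addr0.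
case: (src G e =P v) => [->|_] => [|_]; last by rewrite mul1r add0r.
by rewrite eq_sym => /negPf ->; rewrite mul1r addr0.
Qed.

Lemma pbd_noloop (Q : {set {set V}}) e : e \in pbd G Q -> src G e != dst G e.
Proof. by rewrite inE; apply: contraNneq => ->. Qed.

Lemma deg_pbd (Q : {set {set V}}) v : deg G (pbd G Q) v = inc (edgecap (pbd G Q)) v.
Proof. by apply: degE => e; exact: pbd_noloop. Qed.

Lemma bd_noloop (S : {set V}) e : e \in bd G S -> src G e != dst G e.
Proof. by rewrite inE; apply: contraNneq => ->. Qed.

Lemma deg_bd (S : {set V}) v : deg G (bd G S) v = inc (edgecap (bd G S)) v.
Proof. by apply: degE => e; exact: bd_noloop. Qed.

Lemma deg_ge0 (F : {set E}) v : 0 <= deg G F v.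
Proof. by apply: sumr_ge0 => e _; exact: cap_ge0. Qed.

Lemma sum_fiber (h : E -> V) a (S : {set V}) :
  \sum_(v in S) \sum_(e | h e == v) a e = \sum_(e | h e \in S) a e.
Proof.
rewrite [RHS](partition_big h (mem S)) //=; apply: eq_bigr => v vS.
by apply: eq_bigl => e; case: eqP => [->|]; rewrite ?andbF // vS.
Qed.

Lemma vsum_netout f (S : {set V}) :
  vsum (netout G f) S = \sum_(e | src G e \in S) f e - \sum_(e | dst G e \in S) f e.
Proof. by rewrite /vsum /netout sumrB !sum_fiber. Qed.

(** An edge of [bd G S] has exactly one endpoint in [S], so it is counted once. This makes [bdcap]
    the right denominator in [spread]. *)
Lemma vsum_deg_bd (S : {set V}) : vsum (deg G (bd G S)) S = bdcap G S.
Proof.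
rewrite /vsum (eq_bigr (inc (edgecap (bd G S)))); last by move=> v _; exact: deg_bd.
rewrite /inc big_split /= !sum_fiber /bdcap.
rewrite [X in X + _]big_mkcond [X in _ + X]big_mkcond [RHS]big_mkcond -big_split /=.
apply: eq_bigr => e _; rewrite /edgecap inE.
by case: (src G e \in S); case: (dst G e \in S); rewrite ?mul1r ?mul0r ?addr0 ?add0r.
Qed.

Lemma deg_mono (F F' : {set E}) v : F \subset F' -> deg G F v <= deg G F' v.
Proof.
move=> /subsetP FF'; rewrite /deg [leLHS]big_mkcond [leRHS]big_mkcond.
apply: ler_sum => e _; have := FF' e; have := cap_ge0 G e.
by case: (e \in F); case: (e \in F') => //= c0 h; case: ifP => // _; have := h isT.
Qed.

(* Mark a fraction [p v] of everything passing through [v]; the amount of    *)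
(* marked flow is then [x] at the sources exactly when [p] is a fixed point. *)
Lemma transport f s r x :
    (forall v, 0 <= r v) -> (forall v, `|x v| <= s v) ->
    (forall v, s v - r v <= netout G f v) ->
  exists2 g, (forall e, `|g e| <= `|f e|) &
    forall v, `|x v - netout G g v| <= r v.
Proof.
move=> r0 xs fsr.
pose fp e := Num.max (f e) 0; pose fn e := Num.max (- f e) 0.
have fp0 e : 0 <= fp e by rewrite le_max lexx orbT.
have fn0 e : 0 <= fn e by rewrite le_max lexx orbT.
have fpn e : f e = fp e - fn e by rewrite /fp /fn; case: (leP (f e) 0); case: (leP (- f e) 0); lra.
have afpn e : `|f e| = fp e + fn e.
  rewrite /fp /fn; case: (leP 0 (f e)) => h; [rewrite ger0_norm//|rewrite ltr0_norm//];
  case: (leP (- f e) 0); lra.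
pose out v := \sum_(e | src G e == v) fp e + \sum_(e | dst G e == v) fn e.
pose inp p v : R := \sum_(e | src G e == v) fn e * p (dst G e)
                  + \sum_(e | dst G e == v) fp e * p (src G e).
(* Throughput of [v]: what leaves plus what may stay. Both carry the fraction [p v], so the final
   error is [p v * r v]. *)
pose t v := out v + r v.
have out0 v : 0 <= out v by apply: addr_ge0; apply: sumr_ge0.
have t0 v : 0 <= t v by apply: addr_ge0.
have netE v : netout G f v = out v - inp (fun=> 1) v.
  have -> : inp (fun=> 1) v = \sum_(e | src G e == v) fn e + \sum_(e | dst G e == v) fp e.
    by congr (_ + _); apply: eq_bigr => e _; rewrite mulr1.
  by rewrite /netout /out !(eq_bigr _ (fun e _ => fpn e)) !sumrB; ring.
have inp1 p v : (forall v, `|p v| <= 1) -> `|inp p v| <= inp (fun=> 1) v.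
  move=> p1; rewrite (le_trans (ler_normD _ _))//.
  apply: lerD; apply: (le_trans (ler_norm_sum _ _ _)); apply: ler_sum => e _;
    by rewrite normrM ger0_norm// ler_wpM2l.
have xinp p v : (forall v, `|p v| <= 1) -> `|x v + inp p v| <= t v.
  move=> p1; rewrite (le_trans (ler_normD _ _))//.
  by have := inp1 _ v p1; have := fsr v; have := xs v; rewrite netE /t; lra.
have [|p q pq v|p p1 pE] := @monotone_box_fixpoint R V (fun p v => (x v + inp p v) / t v).
- move=> p p1 v; rewrite normrM normfV (ger0_norm (t0 v)).
  have [->|tn0] := eqVneq (t v) 0; first by rewrite invr0 mulr0.
  by rewrite ler_pdivrMr ?mul1r ?xinp// lt_neqAle eq_sym tn0 t0.
- rewrite ler_wpM2r ?invr_ge0// lerD2l.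
  by apply: lerD; apply: ler_sum => e _; rewrite ler_wpM2l.
exists (fun e => fp e * p (src G e) - fn e * p (dst G e)) => [e|v].
  rewrite afpn (le_trans (ler_normB _ _))//; apply: lerD;
  by rewrite normrM ger0_norm// ler_piMr.
have -> : netout G (fun e => fp e * p (src G e) - fn e * p (dst G e)) v
    = p v * out v - inp p v.
  rewrite /netout !sumrB /out /inp mulrDr !mulr_sumr.
  rewrite (eq_bigr (fun e => p v * fp e)); last by move=> e /eqP ->; rewrite mulrC.
  rewrite [X in _ - (_ - X)](eq_bigr (fun e => p v * fn e)); last by move=> e /eqP ->; rewrite mulrC.
  ring.
have key : p v * t v = x v + inp p v.
  (* For zero throughput the quotient is the default 0, but then [x v + inp p v] vanishes as
     well. *)
  have [tv0|tn0] := eqVneq (t v) 0; last by rewrite pE divfK.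
  by have := xinp p v p1; rewrite tv0 normr_le0 mulr0 => /eqP.
have -> : x v - (p v * out v - inp p v) = p v * r v by move: key; rewrite /t; lra.
by rewrite normrM (ger0_norm (r0 v)) ler_piMl.
Qed.
End Flows.

(** * Partitions of the hierarchy and their common refinements *)

Section Hierarchy.
Variables (V : finType) (Vs : nat -> {set V}) (P : nat -> {set {set V}}) (L : nat).
Hypothesis hP : forall i, (1 <= i <= L)%N -> partition (P i) (Vs i).
Implicit Types (i j k : nat) (u v w : V).

Local Notation Pb := (Pbar Vs P).
Local Notation block i v := (pblock (Pb i) v).

(** By induction: parts of [P i.+1] lie inside [Vs i.+1] and the traces outside it, so the two
    families cannot meet. *)
Lemma Pbar_partition i : (i <= L)%N -> partition (Pb i) [set: V].
Proof.
elim: i => [_|i IH iL].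
  apply/and3P; split.
  - apply/eqP/setP => v; rewrite inE; apply/bigcupP.
    by exists [set v]; rewrite ?set11// imset_f.
  - apply/trivIsetP => _ _ /imsetP[u _ ->] /imsetP[v _ ->] uv.
    by rewrite disjoints1 inE; apply: contraNneq uv => ->.
  - by apply/imsetP => -[v _ /setP/(_ v)]; rewrite !inE eqxx.
have /and3P[/eqP covP tiP nP] := hP (i := i.+1) iL.
have /and3P[/eqP covQ tiQ nQ] := IH (ltnW iL).
have subP A : A \in P i.+1 -> A \subset Vs i.+1.
  by move=> AP; rewrite -covP; apply: bigcup_sup.
apply/and3P; split => /=.
- apply/eqP/setP => v; rewrite inE; apply/bigcupP.
  have [vV|vV] := boolP (v \in Vs i.+1).
    by move: vV; rewrite -covP => /bigcupP[A AP vA]; exists A; rewrite // inE AP.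
  have : v \in cover (Pb i) by rewrite covQ inE.
  case/bigcupP => A AP vA; exists (A :&: ~: Vs i.+1); last by rewrite !inE vA.
  rewrite inE; apply/orP; right; apply/imsetP; exists A => //.
  by rewrite inE AP; apply/set0Pn; exists v; rewrite !inE vA.
- apply/trivIsetP => A B; rewrite !inE.
  have dPQ C D : C \in P i.+1 -> [disjoint C & D :&: ~: Vs i.+1].
    move=> CP; rewrite disjoint_sym disjoints_subset; apply/subsetP => v.
    by rewrite !inE => /andP[_]; apply: contraNN; exact: (subsetP (subP _ CP)).
  move=> /orP[AP|/imsetP[C CP ->]] /orP[BP|/imsetP[D DP ->]] AB.
  + by move/trivIsetP: tiP; apply.
  + exact: dPQ.
  + by rewrite disjoint_sym; exact: dPQ.
  move: CP DP AB; rewrite !inE => /andP[CP _] /andP[DP _] CD.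
  have {}CD : C != D by apply: contraNneq CD => ->.
  move/trivIsetP: tiQ => /(_ _ _ CP DP CD) dCD.
  by rewrite (disjointWl (subsetIl _ _))// (disjointWr (subsetIl _ _)).
- by rewrite inE negb_or nP; apply/imsetP => -[A]; rewrite inE => /andP[_ /[swap] <-]; rewrite eqxx.
Qed.

Lemma mem_block i v : (i <= L)%N -> v \in block i v.
Proof. by move=> /Pbar_partition/cover_partition cov; rewrite mem_pblock cov inE. Qed.

Lemma block_mem i v : (i <= L)%N -> block i v \in Pb i.
Proof. by move=> /Pbar_partition/cover_partition cov; rewrite pblock_mem// cov inE. Qed.

Lemma eq_block i u v : (i <= L)%N -> (block i u == block i v) = (v \in block i u).
Proof.
move=> iL; have pP := Pbar_partition iL.
by rewrite eq_pblock ?(partition_trivIset pP)// (cover_partition pP) inE.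
Qed.

Lemma def_block i B v : (i <= L)%N -> B \in Pb i -> v \in B -> block i v = B.
Proof. by move=> iL; apply: def_pblock; exact: partition_trivIset (Pbar_partition iL). Qed.

Lemma block_in i v : (i < L)%N -> v \in Vs i.+1 -> block i.+1 v \subset Vs i.+1.
Proof.
move=> iL vV; have pP := hP (i := i.+1) iL.
have /bigcupP[B BP vB] : v \in cover (P i.+1) by rewrite (cover_partition pP).
rewrite (@def_block _ B) ?(partitionS pP BP)//.
by rewrite /= inE BP.
Qed.

Lemma block_out i v :
  (i < L)%N -> v \notin Vs i.+1 -> block i.+1 v = block i v :&: ~: Vs i.+1.
Proof.
move=> iL vV; apply: def_block => //; last by rewrite !inE vV mem_block// ltnW.
rewrite /= inE; apply/orP; right; apply/imsetP; exists (block i v) => //.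
rewrite inE block_mem 1?ltnW//; apply/set0Pn; exists v.
by rewrite !inE vV mem_block// ltnW.
Qed.

(** Pointwise form of [refinement_ge]: the part containing [v] is cut out by the blocks of [v]
    itself, with no choice of parts. *)
Definition rblock i v : {set V} := \bigcap_(j < L.+1 | (i <= j)%N) block j v.

Lemma rblockP i u v :
  reflect (forall j, (i <= j <= L)%N -> u \in block j v) (u \in rblock i v).
Proof.
apply: (iffP bigcapP) => [h j /andP[ij jL]|h j ij].
  by have := h (Ordinal (jL : (j < L.+1)%N)); apply.
by apply: h; rewrite ij -ltnS ltn_ord.
Qed.

Lemma mem_rblock i v : v \in rblock i v.
Proof. by apply/rblockP => j /andP[_]; exact: mem_block. Qed.

Lemma eq_rblock i u v : u \in rblock i v -> rblock i u = rblock i v.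
Proof.
move/rblockP => h; apply: eq_bigr => j ij.
have jL : (j <= L)%N by rewrite -ltnS.
by apply/esym/eqP; rewrite eq_block// h// ij.
Qed.

Lemma rblock_block i j v : (i <= j <= L)%N -> rblock i v \subset block j v.
Proof. by move=> ij; apply/subsetP => u /rblockP; apply. Qed.

Lemma rblock_refinement i v : rblock i v \in refinement_ge Vs P L i.
Proof.
rewrite inE; apply/andP; split; first by apply/set0Pn; exists v; exact: mem_rblock.
apply/existsP; exists [ffun j : 'I_L.+1 => block j v]; apply/andP; split.
  by apply/forallP => j; apply/implyP => _; rewrite ffunE block_mem// -ltnS.
by apply/eqP; apply: eq_bigr => j _; rewrite ffunE.
Qed.

(* Outside [Vs i.+1] the parts of level [i.+1] are traces of parts of level  *)
(* [i], so intersecting with the latter changes nothing.                     *)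
Lemma rblock_out i v :
  (i < L)%N -> v \notin Vs i.+1 -> rblock i v = rblock i.+1 v.
Proof.
move=> iL vV; apply/setP => u; apply/rblockP/rblockP => h j /andP[ij jL].
  by apply: h; rewrite (ltnW ij).
move: ij; rewrite leq_eqVlt => /orP[/eqP <-|ij]; last by apply: h; rewrite ij.
have := h i.+1; rewrite leqnn iL block_out// => /(_ isT).
by rewrite inE => /andP[].
Qed.

(** A set closed under [rblock i] is a disjoint union of refinement parts, so sums over it are
    determined part by part. *)
Lemma sum_rblock (R : realType) i (C : {set V}) (x y : V -> R) :
    (i <= L)%N ->
    (forall v, v \in C -> rblock i v \subset C) ->
    (forall v, \sum_(u in rblock i v) x u = \sum_(u in rblock i v) y u) ->
  \sum_(v in C) x v = \sum_(v in C) y v.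
Proof.
move=> iL Csat xy.
rewrite (partition_big (rblock i) predT)//= [RHS](partition_big (rblock i) predT)//=.
apply: eq_bigr => S _.
have [/existsP[w /andP[wC /eqP <-]]|/existsPn no] :=
  boolP [exists w, (w \in C) && (rblock i w == S)]; last first.
  by rewrite !big_pred0// => v; exact/negbTE/no.
have eS v : (v \in C) && (rblock i v == rblock i w) = (v \in rblock i w).
  apply/andP/idP => [[_ /eqP <-]|vw]; first exact: mem_rblock.
  by split; [exact: (subsetP (Csat _ wC))|rewrite (eq_rblock vw)].
by rewrite !(eq_bigl _ _ eS).
Qed.

End Hierarchy.

Lemma sub_bigcup_nat (T : finType) (F : nat -> {set T}) m n j :
  (m <= j < n)%N -> F j \subset \bigcup_(m <= i < n) F i.
Proof.
move=> /andP[mj jn]; rewrite (@big_cat_nat _ _ _ j)//= 1?ltnW//.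
by rewrite [X in _ :|: X]big_ltn// setUCA subsetUl.
Qed.

(** * Moving boundary degrees down the levels *)

Section Routing.
Variables (R : realType) (V E : finType) (G : capgraph R V E) (beta : R) (L : nat).
Variables (Vs : nat -> {set V}) (P : nat -> {set {set V}}).
Hypothesis hP : forall i, (1 <= i <= L)%N -> partition (P i) (Vs i).
Hypothesis hbeta : 1 <= beta.
Hypothesis hflow : forall i, (1 <= i < L)%N ->
  exists2 f : E -> R, congestion_le G f beta &
    sends_receives G f (Vs i.+1)
      (deg G (pbd G (Pbar Vs P i.+1)))
      (fun v => 4%:R^-1 * deg G (pbd G (Pbar Vs P i)) v).

Local Notation Pb := (Pbar Vs P).
Local Notation dP i := (pbd G (Pb i)).

(** Outside [Vs i.+1] the parts are traces of parts of level [i], so they separate the same pairs of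
    vertices. *)
Lemma pbd_out i e : (i < L)%N -> src G e \notin Vs i.+1 -> dst G e \notin Vs i.+1 ->
  (e \in dP i.+1) = (e \in dP i).
Proof.
move=> iL sV tV; rewrite !in_set (eq_block hP _ _ iL) (eq_block hP _ _ (ltnW iL)) (block_out hP)//.
by rewrite in_setI [_ \in ~: _]in_setC tV andbT.
Qed.

Definition cumbd i n : {set E} := \bigcup_(i <= j < n.+1) dP j.

Lemma cumbd_id i : cumbd i i = dP i.
Proof. by rewrite /cumbd big_nat1. Qed.

Lemma cumbdS i n : (i <= n)%N -> cumbd i n.+1 = cumbd i n :|: dP n.+1.
Proof. by move=> le_in; rewrite /cumbd big_nat_recr //= leqW. Qed.

Lemma sub_cumbd i j n : (i <= j <= n)%N -> dP j \subset cumbd i n.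
Proof. by move=> ij; apply: (sub_bigcup_nat (fun k => dP k)). Qed.

(** Potential of the cascade: the first term dominates the demand to be moved, the second is a
    surcharge at the current level. At [n = i] they coincide. *)
Definition load i n e : R := 2%:R * edgecap G (cumbd i n) e + 2%:R * edgecap G (dP n) e.

(** Scaled by 8, the received quarter becomes twice the degree at level [j], which is the surcharge
    in [load i j]. *)
Lemma stage_flow i j : (1 <= i <= j)%N -> (j < L)%N ->
  exists2 g : E -> R, congestion_le G g (8%:R * beta + 4%:R) &
    forall v, inc G (load i j.+1) v - inc G (load i j) v <= netout G g v.
Proof.
move=> /andP[i1 ij] jL.
have [|f fb [r r0 fr]] := @hflow j; first by rewrite jL (leq_trans i1 ij).
pose W := Vs j.+1; pose ec := edgecap G (dP j.+1).
(* Each edge of [dP j.+1] with one end in [W] sends four times its capacity into [W], where [f]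
   takes over. *)
pose cons e : R := 4%:R * ec e * ((dst G e \in W)%:R - (src G e \in W)%:R).
have cons_le e : `|cons e| <= 4%:R * ec e.
  have ec0 : 0 <= 4%:R * ec e by rewrite mulr_ge0// edgecap_ge0.
  rewrite /cons normrM (ger0_norm ec0) ler_piMr//.
  by do 2![case: (_ \in W)]; rewrite /= ?subr0 ?subrr ?sub0r ?normrN ?normr1 ?normr0.
have ec_cap e : ec e <= cap G e.
  by rewrite /ec /edgecap; case: (_ \in _); rewrite ?mul1r ?mul0r ?cap_ge0.
have dP_cum e : e \in dP j -> e \in cumbd i j.
  by apply: (subsetP (sub_cumbd _)); rewrite ij leqnn.
exists (fun e => 8%:R * f e + cons e) => [e|v].
  rewrite (le_trans (ler_normD _ _))// normrM ger0_norm//.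
  by have := fb e; have := cons_le e; have := ec_cap e; lra.
rewrite netoutD netoutZ fr /vrestr -incB -/W.
(* Let D and D' be the degrees at levels [j] and [j.+1]. In [W], the flow [8 f] yields at least 8D'
   - 2D, [cons] costs at most 4D', and the load grows by at most 4D' - 2D. *)
case: (boolP (v \in W)) => vW.
  have /andP[rv0 rv] := r0 v vW.
  rewrite !deg_pbd in rv *.
  have nc : - (4%:R * inc G ec v) <= netout G cons v.
    rewrite -incZ lerNnormlW// (le_trans (ler_norm_netout _ _ _))//.
    by apply: ler_inc => e _.
  have : inc G (fun e => load i j.+1 e - load i j e) v <=
    inc G (fun e => 4%:R * ec e - 2%:R * edgecap G (dP j) e) v.
    apply: ler_inc => e _; rewrite /load cumbdS// /ec /edgecap in_setU.
    have := dP_cum e; have := cap_ge0 G e.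
    by case: (e \in dP j) => c0; [move=> ->|]; case: (e \in cumbd i j); case: (e \in dP j.+1) => //=; lra.
  rewrite [X in _ <= X -> _]incB !incZ; move: nc rv; rewrite -/ec; lra.
(* Outside [W] only [cons] contributes: it covers the growth on edges into [W], while on edges with
   both ends outside [W] the load is unchanged. *)
have -> : netout G cons v = inc G (fun e => 4%:R * ec e *
    ((src G e \in W) || (dst G e \in W))%:R) v.
  rewrite /netout /inc -sumrN; congr (_ + _); apply: eq_bigr => e /eqP ev;
    rewrite /cons ev (negPf vW) /=; [by rewrite subr0|rewrite orbF; ring].
rewrite mulr0 add0r; apply: ler_inc => e _; rewrite /load cumbdS// /ec /edgecap in_setU.
have := dP_cum e; have := cap_ge0 G e; have := @pbd_out j e jL; rewrite -/W.
case: (boolP ((src G e \in W) || (dst G e \in W))) => [_ _|/norP[sW tW] /(_ sW tW) ->] c0.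
  by case: (e \in dP j) => [-> //|_]; case: (e \in cumbd i j); case: (e \in dP j.+1) => /=; lra.
by case: (e \in dP j) => [-> //|_]; case: (e \in cumbd i j) => /=; lra.
Qed.

(** Stage flows add up and the load differences telescope. *)
Lemma cascade_flow i n : (1 <= i)%N -> (i + n <= L)%N ->
  exists2 g : E -> R, congestion_le G g (n%:R * (8%:R * beta + 4%:R)) &
    forall v, inc G (load i (i + n)) v - inc G (load i i) v <= netout G g v.
Proof.
move=> i1; elim: n => [_|n IH]; last rewrite addnS => inL.
  exists (fun=> 0) => [e|v]; first by rewrite normr0 !mul0r.
  by rewrite addn0 subrr /netout !big1 ?subr0.
have [g gc gn] := IH (ltnW inL).
have [|g' gc' gn'] := @stage_flow i (i + n) _ inL; first by rewrite i1 leq_addr.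
exists (fun e => g e + g' e) => [e|v].
  rewrite (le_trans (ler_normD _ _))// -natr1 mulrDl mul1r mulrDl.
  by apply: lerD.
by rewrite netoutD; have := gn v; have := gn' v; lra.
Qed.

(* The [j]-th flow moves the load at [dP j.+1] down to a quarter of it at    *)
(* [dP j]; the load first crosses its edge if that is needed to enter        *)
(* [Vs j.+1], which at most doubles it, so the loads stay bounded.           *)
Lemma transport_down i (x : V -> R) : (1 <= i < L)%N ->
    (forall v, `|x v| <= 2%:R * inc G (edgecap G (cumbd i L)) v) ->
  exists2 g, congestion_le G g (12%:R * beta * (L.-1)%:R) &
    forall v, `|x v - netout G g v| <= 4%:R * deg G (dP i) v.
Proof.
move=> /andP[i1 iL] xb.
have [|f fc fn] := @cascade_flow i (L - i) i1; first by rewrite subnKC// ltnW.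
rewrite subnKC 1?ltnW// in fn.
have dii v : inc G (load i i) v = 4%:R * deg G (dP i) v.
  rewrite deg_pbd -incZ /load cumbd_id.
  by congr (_ + _); apply: eq_bigr => e _; ring.
(* The supply is the load at level [L], whose first term dominates [x]; what may stay behind is the
   load at level [i]. *)
have [v|v|v|g gf gx] := @transport _ _ _ G f
  (fun v => inc G (load i L) v) (fun v => 4%:R * deg G (dP i) v) x.
- by rewrite mulr_ge0// deg_ge0.
- apply: (le_trans (xb v)); rewrite -incZ; apply: ler_inc => e _.
  by rewrite lerDl mulr_ge0// edgecap_ge0.
- by rewrite -dii.
exists g => // e; rewrite (le_trans (gf e))// (le_trans (fc e))//.
apply: ler_wpM2r; first exact: cap_ge0.
(* At most [L.-1] stages as [1 <= i], each costing [8 beta + 4], at most [12 beta] as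
   [1 <= beta]. *)
have Lle : (L - i)%:R <= (L.-1)%:R :> R by rewrite ler_nat -subn1 leq_sub2l.
rewrite [leRHS]mulrC; apply: ler_pM => //; first by rewrite addr_ge0// mulr_ge0// (le_trans _ hbeta).
by have := hbeta; lra.
Qed.

End Routing.

(** * Routing between consecutive levels *)

Section Levels.
Variables (R : realType) (V E : finType) (G : capgraph R V E) (alpha beta : R) (L : nat).
Variables (Vs : nat -> {set V}) (P : nat -> {set {set V}}).
Hypothesis halpha : 1 <= alpha.
Hypothesis hbeta : 1 <= beta.
Hypothesis hP : forall i, (1 <= i <= L)%N -> partition (P i) (Vs i).
Hypothesis hmix : forall i, (1 <= i < L)%N ->
  mixes_simultaneously G
    [set C in Pbar Vs P i.+1 | C \subset Vs i.+1]
    (fun C : {set V} => vrestr (deg G (pbd G (Pbar Vs P i) :|: bd G C)) C)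
    alpha.
Hypothesis hflow : forall i, (1 <= i < L)%N ->
  exists2 f : E -> R, congestion_le G f beta &
    sends_receives G f (Vs i.+1)
      (deg G (pbd G (Pbar Vs P i.+1)))
      (fun v => 4%:R^-1 * deg G (pbd G (Pbar Vs P i)) v).

Local Notation Pb := (Pbar Vs P).
Local Notation dP i := (pbd G (Pb i)).
Local Notation cumbd := (cumbd G Vs P).
Local Notation rblock := (rblock Vs P L).

Lemma mem_part i C v : (i <= L)%N -> C \in Pb i -> (v \in C) = (pblock (Pb i) v == C).
Proof.
move=> iL CP; apply/idP/eqP => [vC|<-]; last exact: (mem_block hP).
exact: (def_block hP).
Qed.

Lemma vsum_vrestr (x : V -> R) (C : {set V}) : vsum (vrestr x C) [set: V] = vsum x C.
Proof.
rewrite /vsum /vrestr [RHS]big_mkcond /=; apply: eq_big => [v|//]; exact: in_setT.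
Qed.

(* Cutting the transporting flow at the boundary of level [i.+1] restores    *)
(* zero net demand in each part; the error is proportional to the boundary   *)
(* degrees, so it can be mixed too.                                          *)
Lemma route_level i (x : V -> R) : (1 <= i < L)%N ->
    (forall v, `|x v| <= 2%:R * inc G (edgecap G (cumbd i L)) v) ->
    (forall v, v \notin Vs i.+1 -> x v = 0) ->
    (forall C, C \in Pb i.+1 -> vsum x C = 0) ->
  exists2 h, routes G h x & congestion_le G h (24%:R * alpha * beta * L%:R).
Proof.
move=> iL xb xout xsum; have /andP[i1 iltL] := iL.
have [g gc gx] := transport_down hP hbeta hflow iL xb.
set kappa := 12%:R * beta * (L.-1)%:R in gc.
have b0 : 0 <= beta by apply: le_trans hbeta.
have a0 : 0 <= alpha by apply: le_trans halpha.
have kappa0 : 0 <= kappa by rewrite /kappa !mulr_ge0.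
pose W := Vs i.+1.
(* A kept edge has both ends in one part of level [i.+1], and that part lies in [W] because it
   contains the source. *)
pose g' e := if (e \notin dP i.+1) && (src G e \in W) then g e else 0.
have g'le e : `|g' e| <= kappa * cap G e.
  by rewrite /g'; case: ifP => _; rewrite ?gc// normr0 mulr_ge0 ?cap_ge0.
have ends e C : C \in Pb i.+1 -> e \notin dP i.+1 -> (src G e \in C) = (dst G e \in C).
  by move=> CP; rewrite inE negbK => /eqP eqb; rewrite !(mem_part _ iltL CP) eqb.
have g'C C : C \in Pb i.+1 -> vsum (netout G g') C = 0.
  move=> CP; rewrite vsum_netout big_mkcond [X in _ - X]big_mkcond -sumrB big1// => e _.
  rewrite /g'; case: (boolP (e \in dP i.+1)) => [_|ne] /=; first by rewrite !if_same subrr.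
  by rewrite (ends e C)// subrr.
have g'out v : v \notin W -> netout G g' v = 0.
  move=> vW; rewrite /netout !big1 ?subr0// => e /eqP ev; rewrite /g'; last first.
    by rewrite ev (negPf vW) andbF.
  case: ifP => // /andP[ne sW]; case/negP: vW.
  have := block_in hP iltL sW => /subsetP; apply.
  by rewrite -ev -(ends e _ _ ne) ?(block_mem hP)// (mem_block hP).
(* The 4 pays for what the transport leaves behind, [kappa] for the flow cut at part boundaries;
   dividing by [m] meets the mixing bound. *)
pose m := 4%:R + kappa.
have m0 : 0 < m by rewrite ltr_pwDl.
pose y v := m^-1 * (x v - netout G g' v).
have [|C|f fr fc] := @hmix i iL (fun C => vrestr y C).
- move=> C; rewrite inE => /andP[CP _]; rewrite /is_demand vsum_vrestr.
  by rewrite /vsum /y -mulr_sumr sumrB [X in X - _]xsum// [X in _ - X]g'C// subrr mulr0.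
- rewrite inE => /andP[CP CW] v; rewrite /vrestr; case: ifP => vC; last by rewrite normr0.
  rewrite /y normrM gtr0_norm ?invr_gt0// ler_pdivrMl//.
  have -> : x v - netout G g' v =
      (x v - netout G g v) + netout G (fun e => g e - g' e) v by rewrite netoutB; ring.
  rewrite (le_trans (ler_normD _ _))// mulrDl; apply: lerD.
    apply: (le_trans (gx v)); rewrite ler_pM2l// deg_mono// subsetUl//.
  rewrite (le_trans (ler_norm_netout _ _ _))//.
  apply: (@le_trans _ _ (kappa * deg G (bd G C) v)); last first.
    apply: ler_wpM2l => //; rewrite deg_mono// subsetUr//.
  rewrite deg_bd -incZ; apply: ler_inc => e ev; rewrite /edgecap.
  case: (boolP (e \in bd G C)) => eC.
    rewrite mul1r /g'; case: (boolP (e \in dP i.+1)) => [_|ne]; first by rewrite subr0 gc.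
    by move: eC; rewrite inE (ends e C)// eqxx.
  (* An edge at [v] not in [bd G C] has both ends in [C], so its flow was kept. *)
  rewrite mul0r mulr0 normr_le0 /g'.
  have [sC tC] : src G e \in C /\ dst G e \in C.
    move: eC; rewrite inE negbK => /eqP.
    by case/orP: ev => /eqP ->; rewrite vC.
  have -> : e \notin dP i.+1 by rewrite inE negbK !(def_block hP iltL CP).
  by rewrite /W (subsetP CW)// subrr.
exists (fun e => g' e + m * \sum_(C in [set C in Pb i.+1 | C \subset W]) f C e) => [v|e].
  rewrite netoutD netoutZ netout_sum.
  rewrite (eq_bigr (fun C => vrestr y C v)) => [|C CA]; last exact: fr.
  have [vW|vW] := boolP (v \in W).
    rewrite (bigD1 (pblock (Pb i.+1) v)) /=; last first.
      by rewrite inE (block_mem hP _ iltL) (block_in hP).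
    rewrite big1 ?addr0 => [|C /andP[]]; last first.
      by rewrite inE => /andP[CP _] neC; rewrite /vrestr (mem_part _ iltL CP) eq_sym (negPf neC).
    by rewrite /vrestr (mem_block hP _ iltL) /y mulVKf ?gt_eqF//; ring.
  rewrite big1 ?mulr0 ?g'out ?xout ?addr0// => C.
  rewrite inE => /andP[_ /subsetP CW]; rewrite /vrestr; case: ifP => // /CW.
  by rewrite (negPf vW).
rewrite (le_trans (ler_normD _ _))// normrM gtr0_norm//.
apply: (@le_trans _ _ (kappa * cap G e + m * (alpha * cap G e))).
  apply: lerD => //; rewrite ler_pM2l// (le_trans _ (fc e))//.
  exact: ler_norm_sum.
rewrite mulrA -mulrDl ler_wpM2r ?cap_ge0//.
(* With l = L - 1 the total is 12 beta l + (4 + 12 beta l) alpha, at most 24 alpha beta (l + 1). *)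
have -> : L%:R = (L.-1)%:R + 1 :> R by rewrite natr1 prednK// (leq_ltn_trans _ iltL).
rewrite /m /kappa; set l := (L.-1)%:R.
have l0 : 0 <= l by rewrite /l.
have h1 : 0 <= beta * l * (alpha - 1) by rewrite !mulr_ge0// subr_ge0.
have h2 : 0 <= alpha * (beta - 1) by rewrite mulr_ge0// subr_ge0.
by lra.
Qed.

(* The total demand of each part [S] of the refinement is spread over the    *)
(* boundary of [S]; on parts with [bdcap G S = 0] the value is the junk 0,   *)
(* which is right because the demand of [S] vanishes.                        *)
Definition spread (b : V -> R) i v : R :=
  vsum b (rblock i v) / bdcap G (rblock i v) * deg G (bd G (rblock i v)) v.

(** * Sums and bounds for the spread demand *)

Section Spread.
Variable b : V -> R.
Hypothesis hb : forall i v, (1 <= i <= L)%N ->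
  `|vsum b (rblock i v)| <= bdcap G (rblock i v).

Lemma bdcap0_vsum i v : (1 <= i <= L)%N ->
  bdcap G (rblock i v) = 0 -> vsum b (rblock i v) = 0.
Proof. by move=> iL c0; have := hb v iL; rewrite c0 normr_le0 => /eqP. Qed.

(** On one refinement part the ratio is constant and the degrees sum to the boundary capacity, which
    cancels; zero capacity forces zero demand by [hb]. *)
Lemma vsum_spread i (C : {set V}) : (1 <= i <= L)%N ->
  (forall v, v \in C -> rblock i v \subset C) -> vsum (spread b i) C = vsum b C.
Proof.
move=> iL Csat; have /andP[_ iL'] := iL; apply: (sum_rblock hP iL' Csat) => v.
rewrite (eq_bigr (fun u => vsum b (rblock i v) / bdcap G (rblock i v) *
  deg G (bd G (rblock i v)) u)) => [|u uv]; last by rewrite /spread (eq_rblock hP uv).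
rewrite -mulr_sumr -[X in _ * X]/(vsum _ _) vsum_deg_bd -[RHS]/(vsum _ _).
have [c0|c0] := eqVneq (bdcap G (rblock i v)) 0; last by rewrite divfK.
by rewrite c0 mulr0 bdcap0_vsum.
Qed.

(** By [hb] the ratio is at most 1 in absolute value, leaving a boundary degree; an edge of that
    boundary is cut at some level from [j] to [L]. *)
Lemma spread_le i j v : (1 <= i <= j)%N -> (j <= L)%N ->
  `|spread b j v| <= inc G (edgecap G (cumbd i L)) v.
Proof.
move=> /andP[i1 ij] jL; have j1L : (1 <= j <= L)%N by rewrite (leq_trans i1 ij).
set S := rblock j v.
apply: (@le_trans _ _ (deg G (bd G S) v)).
  rewrite /spread normrM (ger0_norm (deg_ge0 _ _ _)) ler_piMl ?deg_ge0//.
  have c0 : 0 <= bdcap G S by apply: sumr_ge0 => e _; exact: cap_ge0.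
  rewrite normrM normfV (ger0_norm c0).
  have [->|cn0] := eqVneq (bdcap G S) 0; first by rewrite invr0 mulr0.
  by rewrite ler_pdivrMr ?mul1r ?hb// lt_neqAle eq_sym cn0 c0.
rewrite deg_bd; apply: ler_inc => e ev.
rewrite /edgecap ler_wpM2r ?cap_ge0// ler_nat.
have [eS|//] := boolP (e \in bd G S); rewrite lt0b; move: eS.
apply: contraLR => ecum.
have eqb k : (j <= k <= L)%N -> pblock (Pb k) (src G e) == pblock (Pb k) (dst G e).
  move=> /andP[jk kL]; apply: contraNT ecum => eb.
  have ikL : (i <= k <= L)%N by rewrite kL (leq_trans ij).
  by apply: (subsetP (sub_cumbd G Vs P ikL)); rewrite inE.
suff [sS tS] : src G e \in S /\ dst G e \in S by rewrite inE sS tS.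
split; apply/rblockP => k jk; have /andP[_ kL] := jk; have := eqb k jk;
  case/orP: ev => /eqP ->; rewrite ?(mem_block hP _ kL)// => eq.
- by rewrite -(eq_block hP _ _ kL) eq_sym.
- by rewrite -(eq_block hP _ _ kL).
Qed.

(** Both refinements refine level [i.+1], so both spreads have the sum of [b] on each of its parts.
    The two terms give the factor 2 in [route_level]. *)
Lemma route_spread i : (1 <= i < L)%N ->
  exists2 h, routes G h (fun v => spread b i v - spread b i.+1 v)
    & congestion_le G h (24%:R * alpha * beta * L%:R).
Proof.
move=> iL; have /andP[i1 iltL] := iL; apply: (route_level iL) => [v|v vV|C CP].
- rewrite (le_trans (ler_normB _ _))// mulr2n mulrDl mul1r.
  by apply: lerD; apply: spread_le; rewrite ?i1 ?leqnn ?leqnSn// ltnW.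
- by rewrite /spread (rblock_out hP iltL vV) subrr.
have sat k : (k <= i.+1)%N -> forall v, v \in C -> rblock k v \subset C.
  move=> ki v vC; rewrite -(def_block hP iltL CP vC).
  by apply: rblock_block; rewrite ki.
rewrite /vsum sumrB -![X in X - _]/(vsum _ _) -![X in _ - X]/(vsum _ _).
by rewrite !vsum_spread ?subrr ?i1 1?ltnW//; apply: sat.
Qed.

End Spread.
End Levels.

(** * Telescoping over the levels *)

Theorem theorem6p1 (R : realType) (V E : finType) (G : capgraph R V E)
  (alpha beta : R) (L : nat)
  (Vs : nat -> {set V}) (P : nat -> {set {set V}})
  (halpha : 1 <= alpha) (hbeta : 1 <= beta) (hL : (1 <= L)%N)
  (hP : forall i, (1 <= i <= L)%N -> partition (P i) (Vs i))
  (hfirst : Pbar Vs P 1 = singletons V)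
  (hlast : Pbar Vs P L = [set [set: V]])
  (hmix : forall i, (1 <= i < L)%N ->
     mixes_simultaneously G
       [set C in Pbar Vs P i.+1 | C \subset Vs i.+1]
       (fun C : {set V} => vrestr (deg G (pbd G (Pbar Vs P i) :|: bd G C)) C)
       alpha)
  (hflow : forall i, (1 <= i < L)%N ->
     exists2 f : E -> R, congestion_le G f beta &
       sends_receives G f (Vs i.+1)
         (deg G (pbd G (Pbar Vs P i.+1)))
         (fun v => 4%:R^-1 * deg G (pbd G (Pbar Vs P i)) v)) :
  congestion_approximator G (approx_family Vs P L)
    (48%:R * alpha * beta * L%:R ^+ 2).
Proof.
move=> b b_dem bC.
have hb i v : (1 <= i <= L)%N ->
    `|vsum b (rblock Vs P L i v)| <= bdcap G (rblock Vs P L i v).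
  move=> iL; apply: bC.
  have /subsetP := sub_bigcup_nat (refinement_ge Vs P L) (iL : (1 <= i < L.+1)%N).
  by apply; apply: rblock_refinement.
set q := 24%:R * alpha * beta * L%:R.
have route n : (n < L)%N ->
    exists2 h, routes G h (fun v => spread G L Vs P b 1 v - spread G L Vs P b n.+1 v)
      & congestion_le G h (n%:R * q).
  elim: n => [_|n IH nL].
    exists (fun=> 0) => [v|e]; last by rewrite normr0 !mul0r.
    by rewrite subrr /netout !big1 ?subr0.
  have [h hr hc] := IH (ltnW nL).
  have [h' hr' hc'] := route_spread halpha hbeta hP hmix hflow hb (i := n.+1) nL.
  exists (fun e => h e + h' e) => [v|e]; first by rewrite netoutD hr hr'; ring.
  rewrite (le_trans (ler_normD _ _))// -natr1 !mulrDl mul1r.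
  by apply: lerD; [exact: hc|exact: hc'].
have [|h hr hc] := route L.-1; first by rewrite prednK.
(* At level 1 the part of [v] is [[set v]], whose boundary capacity is the degree of [v]; if that is
   zero, so is [b v]. *)
have first v : spread G L Vs P b 1 v = b v.
  have rv : rblock Vs P L 1 v = [set v].
    apply/eqP; rewrite eqEsubset sub1set (mem_rblock hP) andbT.
    rewrite (subset_trans (rblock_block _ _ _ (j := 1) _)) ?hL//.
    by rewrite (@def_block _ _ _ _ hP _ [set v])// ?set11// hfirst imset_f.
  have := bdcap0_vsum hb (i := 1) (v := v); rewrite /spread rv hL => /(_ isT).
  have := vsum_deg_bd G [set v]; rewrite /vsum !big_set1 => ->.
  have [->|c0] := eqVneq (bdcap G [set v]) 0; last by rewrite divfK.
  by rewrite mulr0 => ->.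
have last v : spread G L Vs P b L v = 0.
  suff rv : rblock Vs P L L v = [set: V] by rewrite /spread rv b_dem !mul0r.
  apply/eqP; rewrite -subTset; apply/subsetP => u _; apply/rblockP => j.
  rewrite -eqn_leq => /eqP <-.
  by rewrite (@def_block _ _ _ _ hP _ [set: V])// hlast set11.
exists h => [v|e]; first by rewrite hr prednK// first last subr0.
rewrite (le_trans (hc e))// ler_wpM2r ?cap_ge0//.
have ab0 : 0 <= alpha * beta by rewrite mulr_ge0// (le_trans ler01)//.
(* The [L.-1] steps cost [q] each, and [2 L q] is the claimed quality. *)
have lL : (L.-1)%:R <= 2%:R * L%:R :> R by rewrite -natrM ler_nat (leq_trans (leq_pred _))// leq_pmull.
have -> : 48%:R * alpha * beta * L%:R ^+ 2 = 2%:R * L%:R * q by rewrite /q; ring.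
by rewrite ler_wpM2r// /q mulr_ge0// -mulrA mulr_ge0.
Qed.
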